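(* Let $H_1$ be an at least $2$-dimensional linear space over a sfield $F_1$, equipped with a non-degenerate sesquilinear form $(\cdot,\cdot)_1$, and let $H_2$ be a linear space over a sfield $F_2$, equipped with a sesquilinear form $(\cdot,\cdot)_2$. Let $\phi \colon H_1 \to H_2$ be a semilinear map with associated homomorphism $\sigma\colon F_1\to F_2$ and assume that $u \perp v$ implies $\phi(u) \perp \phi(v)$ for any $u, v \in H_1$. Then there is a unique $\lambda \in F_2$ such that \[ (\phi(u),\phi(v))_2 \;=\; {(u,v)_1}^\sigma \, \lambda \] holds for any $u, v \in H_1$.
   Context: A sfield is a skew field (division ring); linear spaces are left linear spaces. A sesquilinear form on a linear space $H$ over a sfield $F$ equipped with an antiautomorphism $\ast$ is a map $(\cdot,\cdot)\colon H\times H\to F$ with $(\alpha u+\beta v,w)=\alpha(u,w)+\beta(v,w)$ and $(w,\alpha u+\beta v)=(w,u)\alpha^\ast+(w,v)\beta^\ast$ for all $u,v,w\in H$, $\alpha,\beta\in F$. No symmetry (and no orthosymmetry) of the forms is assumed. The form is non-degenerate if no nonzero vector $v$ satisfies $(u,v)=0$ for all $u\in H$ and no nonzero vector $u$ satisfies $(u,v)=0$ for all $v\in H$. We write $u\perp v$ if $(u,v)=0$ (in the respective space). A map $\phi\colon V_1\to V_2$ between linear spaces over sfields $F_1,F_2$ is semilinear with associated homomorphism $\sigma$ if it is additive and $\sigma\colon F_1\to F_2$ is a (unital) ring homomorphism with $\phi(\alpha u)=\alpha^\sigma\phi(u)$ for all $u\in V_1$, $\alpha\in F_1$, where $\alpha^\sigma$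 denotes the image of $\alpha$ under $\sigma$. *)

(* Defs.v *)
From HB Require Import structures.
From mathcomp Require Import all_boot all_order all_algebra.

Set Implicit Arguments.
Unset Strict Implicit.
Unset Printing Implicit Defensive.

Import GRing.Theory.
Local Open Scope ring_scope.

(* MathComp has no structure for skew fields.  [unitRingType] is a nontrivial,
   possibly noncommutative ring with two-sided inverses of its units, so asking
   every nonzero element to be a unit is exactly being a skew field. *)
Definition is_sfield (F : unitRingType) : Prop := GRing.field_axiom F.

Definition is_antiautomorphism (F : nzRingType) (star : F -> F) : Prop :=
  [/\ bijective star,
      {morph star : a b / a + b},
      star 1 = 1
    & forall a b, star (a * b) = star b * star a].

(* Despite its name, [{bilinear U -> V -> W | s & t}] takes arbitrary scaling
   operations [s] and [t]. *)
Notation sesquilinear_form H star :=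
  ({bilinear H -> H -> _ | *%R & (fun a x => x * star a)}).

Lemma sesquilinear_formP (F : nzRingType) (star : F -> F) (H : lmodType F)
    (f : sesquilinear_form H star) :
  (forall (a b : F) (u v w : H),
     f (a *: u + b *: v) w = a * f u w + b * f v w) /\
  (forall (a b : F) (u v w : H),
     f w (a *: u + b *: v) = f w u * star a + f w v * star b).
Proof.
case: f => f [[addl addr scl scr]] /=.
have addE (V W : zmodType) (g : V -> W) :
    zmod_morphism g -> {morph g : x y / x + y}.
  move=> gB x y; have gN z : g (- z) = - g z.
    by rewrite -[- z]sub0r gB -{1}(subrr z) gB subrr sub0r.
  by rewrite -{1}[y]opprK gB gN opprK.
split=> a b u v w.
  have := addE _ _ _ (addl w) (a *: u) (b *: v).
  by rewrite /= (scl w a u) (scl w b v).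
by rewrite (addE _ _ _ (addr w)) !(scr w).
Qed.

Definition nondegenerate_form (F : nzRingType) (H : lmodType F)
    (f : H -> H -> F) : Prop :=
  (forall v : H, (forall u : H, f u v = 0) -> v = 0) /\
  (forall u : H, (forall v : H, f u v = 0) -> u = 0).

Definition orthogonal_for (F : nzRingType) (H : lmodType F)
    (f : H -> H -> F) (u v : H) : Prop := f u v = 0.

Definition linearly_independent (F : nzRingType) (H : lmodType F) (n : nat)
    (e : 'I_n -> H) : Prop :=
  forall c : 'I_n -> F, \sum_(i < n) c i *: e i = 0 -> forall i, c i = 0.

(* [H] may be infinite-dimensional, so [vectType] and [\dim] do not apply. *)
Definition dim_at_least (F : nzRingType) (n : nat) (H : lmodType F) : Prop :=
  exists e : 'I_n -> H, linearly_independent e.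

(* Main.v *)
Require Import Defs.
From HB Require Import structures.
From mathcomp Require Import all_boot all_order all_algebra.
From Stdlib Require Import Classical.

(** For fixed [v != 0] the map [u |-> (phi u, phi v)] vanishes on the kernel of
    the functional [(_, v)], hence equals [sigma (_, v)] times a constant
    [l_v].  If [v1] and [v2] are independent, non-degeneracy gives [u]
    orthogonal to [v1] but not to [v2]; evaluating
    [(phi u, phi (v1 + v2)) = (phi u, phi v1) + (phi u, phi v2)] at such a [u]
    yields [l_(v1 + v2) = l_v2], and by symmetry [l_(v1 + v2) = l_v1].
    Two dependent vectors are compared through a third one, independent of
    both, which exists because the dimension is at least two. *)

Set Implicit Arguments.
Unset Strict Implicit.
Unset Printing Implicit Defensive.

Import GRing.Theory.
Local Open Scope ring_scope.

(** Some value [f u v] is nonzero, hence invertible, and [u] can be rescaled on the left by its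
    inverse. *)
Lemma nondegenerate_normalized (F : unitRingType) (hF : is_sfield F)
    (star : F -> F) (H : lmodType F) (f : sesquilinear_form H star)
    (hnd : nondegenerate_form f) (v : H) :
  v != 0 -> exists w, f w v = 1.
Proof.
move=> /eqP v0; apply: NNPP => noW; apply: v0; apply: (proj1 hnd) => u.
apply/eqP/negPn/negP => /hF fuU; apply: noW.
by exists ((f u v)^-1 *: u); rewrite linearZl_LR mulVr.
Qed.

(** With [f w v1 = 1], each [u - f u v1 *: w] is killed by [f _ v1], hence by [f _ v2], so
    [f u v2 = f u v1 * f w v2] for all [u]. *)
Lemma orthogonal_sub_line (F : unitRingType) (hF : is_sfield F)
    (star : F -> F) (hs : is_antiautomorphism star) (H : lmodType F)
    (f : sesquilinear_form H star) (hnd : nondegenerate_form f) (v1 v2 : H) :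
  v1 != 0 -> (forall u, f u v1 = 0 -> f u v2 = 0) -> exists a, v2 = a *: v1.
Proof.
move=> v1n0 sub; have [w fw] := nondegenerate_normalized hF hnd v1n0.
have [[star' _ starK] _ _ _] := hs.
(* Scalars leave the second argument through [star], so the factor [f w v2] has to be pulled back
   along it. *)
exists (star' (f w v2)).
apply: subr0_eq; apply: (proj1 hnd) => u.
rewrite linearBr linearZr_LR /= starK.
have /sub : f (u - f u v1 *: w) v1 = 0 by rewrite linearBl linearZl_LR fw mulr1 subrr.
by rewrite linearBl linearZl_LR.
Qed.

Lemma orthogonal_separating (F : unitRingType) (hF : is_sfield F)
    (star : F -> F) (hs : is_antiautomorphism star) (H : lmodType F)
    (f : sesquilinear_form H star) (hnd : nondegenerate_form f) (v1 v2 : H) :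
  v1 != 0 -> (forall a, v2 <> a *: v1) -> exists2 u, f u v1 = 0 & f u v2 != 0.
Proof.
move=> v1n0 indep; apply: NNPP => noU.
have [|a] := orthogonal_sub_line hF hs hnd (v2 := v2) v1n0; last exact: indep.
move=> u fu1; apply/eqP/negPn/negP => fu2.
by apply: noU; exists u.
Qed.

Lemma dim_ge2_off_line (F : unitRingType) (hF : is_sfield F) (H : lmodType F)
    (hdim : dim_at_least 2 H) (v : H) :
  exists w, forall a, w <> a *: v.
Proof.
have [e he] := hdim; apply: NNPP => noW.
have line w : exists a, w = a *: v.
  by apply: NNPP => now; apply: noW; exists w => a aP; apply: now; exists a.
have [[a ea] [b eb]] := (line (e ord0), line (e ord_max)).
have a0 : a != 0.
  apply/eqP => a0; pose c (i : 'I_2) : F := if i == ord0 then 1 else 0.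
  suff /he/(_ ord0)/eqP : \sum_(i < 2) c i *: e i = 0.
    by rewrite /c eqxx oner_eq0.
  by rewrite big_ord_recl big_ord1 /c /= ea a0 !scale0r scaler0 addr0.
(* From [e ord0 = a *: v] and [e ord_max = b *: v], eliminating [v] gives this dependence. *)
pose c (i : 'I_2) : F := if i == ord0 then b * a^-1 else -1.
suff /he/(_ ord_max)/eqP : \sum_(i < 2) c i *: e i = 0.
  by rewrite /c /= oppr_eq0 oner_eq0.
rewrite big_ord_recl big_ord1 /c /= ea.
have -> : lift ord0 ord0 = ord_max :> 'I_2 by apply: val_inj.
by rewrite eb !scalerA divrK ?hF // mulN1r scaleNr subrr.
Qed.

Lemma off_line_neq0 (F : nzRingType) (H : lmodType F) (v w : H) :
  (forall a, w <> a *: v) -> w != 0.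
Proof. by move=> wv; apply/eqP => w0; apply: (wv 0); rewrite scale0r. Qed.

Lemma off_line_sym (F : unitRingType) (hF : is_sfield F) (H : lmodType F)
    (v w : H) :
  v != 0 -> (forall a, w <> a *: v) -> forall a, v <> a *: w.
Proof.
move=> v0 wv a va; have aU : a \is a GRing.unit.
  apply: hF; apply/eqP => a0; move: v0.
  by rewrite va a0 scale0r eqxx.
by apply: (wv a^-1); rewrite va scalerA mulVr ?scale1r.
Qed.

(** Here [l] may still depend on [v]; the theorem asks for one value that serves every [v]. *)
Definition pullback_coef (F1 F2 : unitRingType) (star1 : F1 -> F1)
    (star2 : F2 -> F2) (H1 : lmodType F1) (H2 : lmodType F2)
    (form1 : sesquilinear_form H1 star1) (form2 : sesquilinear_form H2 star2)
    (sigma : F1 -> F2) (phi : H1 -> H2) (v : H1) (l : F2) : Prop :=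
  forall u, form2 (phi u) (phi v) = sigma (form1 u v) * l.

(** The vector [u - form1 u v *: w] is orthogonal to [v]; applying [phi] and expanding gives the
    formula. *)
Lemma pullback_coef_normalized (F1 F2 : unitRingType) (star1 : F1 -> F1)
    (star2 : F2 -> F2) (H1 : lmodType F1) (H2 : lmodType F2)
    (form1 : sesquilinear_form H1 star1) (form2 : sesquilinear_form H2 star2)
    (sigma : {rmorphism F1 -> F2})
    (phi : {linear H1 -> H2 | sigma \; *:%R})
    (hphi : forall u v : H1, orthogonal_for form1 u v ->
              orthogonal_for form2 (phi u) (phi v)) (v w : H1) :
  form1 w v = 1 ->
  pullback_coef form1 form2 sigma phi v (form2 (phi w) (phi v)).
Proof.
move=> fw u.
have /hphi : orthogonal_for form1 (u - form1 u v *: w) v.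
  by rewrite /orthogonal_for linearBl linearZl_LR fw mulr1 subrr.
rewrite /orthogonal_for linearB linearZ /= linearBl linearZl_LR.
exact: subr0_eq.
Qed.

Lemma pullback_coef_sum (F1 F2 : unitRingType)
    (hF1 : is_sfield F1) (star1 : F1 -> F1) (star2 : F2 -> F2)
    (hstar1 : is_antiautomorphism star1)
    (H1 : lmodType F1) (H2 : lmodType F2)
    (form1 : sesquilinear_form H1 star1) (form2 : sesquilinear_form H2 star2)
    (hnd : nondegenerate_form form1) (sigma : {rmorphism F1 -> F2})
    (phi : {linear H1 -> H2 | sigma \; *:%R}) (v1 v2 : H1) (l l1 l2 : F2) :
  v1 != 0 -> (forall a, v2 <> a *: v1) ->
  pullback_coef form1 form2 sigma phi v1 l1 ->
  pullback_coef form1 form2 sigma phi v2 l2 ->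
  pullback_coef form1 form2 sigma phi (v1 + v2) l -> l = l2.
Proof.
move=> v1n0 indep c1 c2 c.
have [u fu1 /hF1 fu2] := orthogonal_separating hF1 hstar1 hnd v1n0 indep.
have := c u; rewrite linearD !linearDr c1 c2 fu1 rmorph0 mul0r !add0r.
(* [sigma] maps the unit [form1 u v2] to a unit, which cancels on the left. *)
by move/esym; apply: mulrI; apply: rmorph_unit.
Qed.

Lemma pullback_coef_indep (F1 F2 : unitRingType)
    (hF1 : is_sfield F1) (star1 : F1 -> F1) (star2 : F2 -> F2)
    (hstar1 : is_antiautomorphism star1)
    (H1 : lmodType F1) (H2 : lmodType F2)
    (form1 : sesquilinear_form H1 star1) (form2 : sesquilinear_form H2 star2)
    (hnd : nondegenerate_form form1) (sigma : {rmorphism F1 -> F2})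
    (phi : {linear H1 -> H2 | sigma \; *:%R})
    (hphi : forall u v : H1, orthogonal_for form1 u v ->
              orthogonal_for form2 (phi u) (phi v))
    (v1 v2 : H1) (l1 l2 : F2) :
  v1 != 0 -> (forall a, v2 <> a *: v1) ->
  pullback_coef form1 form2 sigma phi v1 l1 ->
  pullback_coef form1 form2 sigma phi v2 l2 -> l1 = l2.
Proof.
move=> v1n0 indep c1 c2.
have sumn0 : v1 + v2 != 0.
  apply/eqP => /eqP; rewrite addr_eq0 => /eqP v12; apply: (indep (-1)).
  by rewrite scaleN1r v12 opprK.
have [l c] : exists l, pullback_coef form1 form2 sigma phi (v1 + v2) l.
  have [w fw] := nondegenerate_normalized hF1 hnd sumn0.
  by eexists; apply: pullback_coef_normalized hphi _ _ fw.
rewrite -(pullback_coef_sum hF1 hstar1 hnd v1n0 indep c1 c2 c).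
(* The same comparison with [v1] and [v2] exchanged. *)
rewrite addrC in c; apply/esym.
apply: (pullback_coef_sum hF1 hstar1 hnd _ _ c2 c1 c).
  exact: off_line_neq0 indep.
exact: off_line_sym.
Qed.

Theorem theorem4p5
    (F1 F2 : unitRingType) (hF1 : is_sfield F1) (hF2 : is_sfield F2)
    (star1 : F1 -> F1) (star2 : F2 -> F2)
    (hstar1 : is_antiautomorphism star1) (hstar2 : is_antiautomorphism star2)
    (H1 : lmodType F1) (H2 : lmodType F2)
    (hdim : dim_at_least 2 H1)
    (form1 : sesquilinear_form H1 star1) (form2 : sesquilinear_form H2 star2)
    (hnd : nondegenerate_form form1)
    (sigma : {rmorphism F1 -> F2})
    (phi : {linear H1 -> H2 | sigma \; *:%R})
    (hphi : forall u v : H1, orthogonal_for form1 u v ->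
              orthogonal_for form2 (phi u) (phi v)) :
  exists! lambda : F2,
    forall u v : H1, form2 (phi u) (phi v) = sigma (form1 u v) * lambda.
Proof.
(* The line through [0] is trivial, so this only produces a nonzero vector. *)
have [v0 /off_line_neq0 v0n0] := dim_ge2_off_line hF1 hdim 0.
have coefE v : v != 0 -> exists l, pullback_coef form1 form2 sigma phi v l.
  move=> /(nondegenerate_normalized hF1 hnd)[w fw].
  by eexists; apply: (pullback_coef_normalized hphi fw).
have coef_indep := pullback_coef_indep hF1 hstar1 hnd hphi.
have [w0 fw0] := nondegenerate_normalized hF1 hnd v0n0.
have c0 := pullback_coef_normalized hphi fw0.
exists (form2 (phi w0) (phi v0)); split; last first.
  (* Uniqueness: since [form1 w0 v0 = 1], the identity at this pair reads off the constant. *)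
  by move=> l /(_ w0 v0); rewrite fw0 rmorph1 mul1r.
move=> u v; have [->|vn0] := eqVneq v 0.
  by rewrite linear0 !linear0r rmorph0 mul0r.
have [l c] := coefE v vn0; rewrite c; congr (_ * _); apply/esym.
case: (classic (forall a, v <> a *: v0)) => [indep|/not_all_not_ex[a va]].
  exact: coef_indep indep c0 c.
(* As [v = a *: v0], a vector [v3] off the line of [v0] is also off that of [v], so both constants
   equal [l3]. *)
have [v3 indep3] := dim_ge2_off_line hF1 hdim v0.
have [l3 c3] := coefE v3 (off_line_neq0 indep3).
rewrite (coef_indep _ _ _ _ v0n0 indep3 c0 c3).
apply/esym; apply: (coef_indep _ _ _ _ vn0 _ c c3) => b.
by rewrite va scalerA; apply: indep3.
Qed.
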